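(* Let $\mathcal P=\{C_k\}_{k\in\mathbb N\cup\{0\}}$ be a packing whose residual set $\mathcal S$ is homogeneous, and let $N(x)=\#\{k : (\operatorname{diam} C_k)^{-1}\le x\}$, $x\in\mathbb R$, be its curvature distribution function. Then $$\limsup_{x\to\infty}\frac{\log N(x)}{\log x}=\dim_{ubox}\mathcal S,\qquad \liminf_{x\to\infty}\frac{\log N(x)}{\log x}=\dim_{lbox}\mathcal S.$$
   Context: Packing: a collection $\{C_k\}_{k\in\mathbb N\cup\{0\}}$ of simple closed curves in the plane, with $D_k$ denoting the bounded component of the complement of $C_k$, such that $C_k\subset\overline{D_0}$ for every $k\in\mathbb N$ and $D_j\cap D_k=\emptyset$ for all $j,k\in\mathbb N$ with $j\ne k$. Its residual set is the compact set $\mathcal S=\overline{D_0}\setminus\bigcup_{k\in\mathbb N}D_k$. $B(p,r)$ denotes the open disc of radius $r$ centered at $p$; $\operatorname{diam}$ and $\operatorname{dist}$ are Euclidean diameter and distance. Consider the following conditions. (A) Roundness: there is a constant $\alpha\ge1$ such that for each $D_k$ there exist inscribed and circumscribed concentric circles of radii $r_k$ and $R_k$, respectively (i.e. a point $p_k$ with $B(p_k,r_k)\subset D_k\subset\overline{B(p_k,R_k)}$), with $R_k/r_k\le\alpha$. (B) There is a constant $\beta\ge1$ such that for any $p\in\mathcal S$ and any $0<r\le\operatorname{diam}\mathcal S$ there exists a curve $C_k$ with $C_k\cap B(p,r)\neq\emptyset$ and $\frac1\beta r\le\operatorname{diam} C_k\le\beta r$. (C) Relative separation: there is a constant $\delta>0$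 such that for any $j\ne k$, $\dfrac{\operatorname{dist}(C_j,C_k)}{\min\{\operatorname{diam} C_j,\operatorname{diam} C_k\}}\ge\delta$. (D) Co-fatness: there is a constant $\tau>0$ such that for every $k$ and each disc $B(p,r)$ that is centered at a point of $D_k$ and does not contain $D_k$, $\operatorname{area}(D_k\cap B(p,r))\ge\tau r^2$. The residual set $\mathcal S$ is homogeneous if it satisfies (A), (B) and (C), or it satisfies (A), (B) and (D). Minkowski dimensions: for $\epsilon>0$ let $n(\epsilon)$ be the maximal number of disjoint open discs of radius $\epsilon$ centered on $\mathcal S$. Then $\dim_{ubox}\mathcal S=\limsup_{\epsilon\to0}\frac{\log n(\epsilon)}{\log(1/\epsilon)}$ and $\dim_{lbox}\mathcal S=\liminf_{\epsilon\to0}\frac{\log n(\epsilon)}{\log(1/\epsilon)}$. *)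

(* Defs.v *)
(* MathComp / MathComp-Analysis. *)
From HB Require Import structures.
From mathcomp Require Import all_boot all_order all_algebra.
From mathcomp Require Import all_classical all_reals all_analysis.

Set Implicit Arguments.
Unset Strict Implicit.
Unset Printing Implicit Defensive.

Import Order.TTheory GRing.Theory Num.Theory.
Import numFieldNormedType.Exports.

Local Open Scope classical_set_scope.
Local Open Scope ring_scope.

Section plane.
Context {R : realType}.
Implicit Types (p q : R * R) (A B : set (R * R)) (r : R).

(* The library norm on R * R is the sup norm: the topology, the bounded sets
   and the measurable sets are the usual ones, but the metric notions have to
   be built on the Euclidean distance. *)
Definition eucl_dist p q : R :=
  Num.sqrt ((p.1 - q.1) ^+ 2 + (p.2 - q.2) ^+ 2).

Definition disc p r : set (R * R) := [set q | eucl_dist p q < r].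

Definition diam A : R := sup [set eucl_dist p q | p in A & q in A].

Definition setdist A B : R := inf [set eucl_dist p q | p in A & q in B].

Definition area : set (R * R) -> \bar R :=
  (@lebesgue_measure R \x @lebesgue_measure R)%E.

Definition simple_closed_curve A : Prop :=
  exists g : R -> R * R,
    [/\ {within `[0, 1], continuous g}, g 0 = g 1,
        set_inj `[0, 1[ g & A = g @` `[0, 1]].

(* For a simple closed curve A, such a B exists and is unique by the Jordan
   curve theorem. *)
Definition bounded_complement_component A B : Prop :=
  bounded_set B /\ exists2 p, (~` A) p & B = connected_component (~` A) p.

End plane.

Section packing.
Context {R : realType}.
(* The curves C_k, and the regions D_k that they bound, for k >= 0.  An index
   k >= 1 is written k.+1. *)
Implicit Types (C D : nat -> set (R * R)) (S : set (R * R)).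

Definition packing C D : Prop :=
  [/\ forall k, simple_closed_curve (C k),
      forall k, bounded_complement_component (C k) (D k),
      forall k, C k.+1 `<=` closure (D 0%N) &
      forall j k, j != k -> D j.+1 `&` D k.+1 = set0].

Definition residual_set D : set (R * R) :=
  closure (D 0%N) `\` \bigcup_k D k.+1.

Definition roundness D : Prop :=
  exists2 alpha : R, 1 <= alpha & forall k, exists (p : R * R) (r r' : R),
    [/\ 0 < r, disc p r `<=` D k, D k `<=` closure (disc p r') &
        r' / r <= alpha].

Definition all_scales C S : Prop :=
  exists2 beta : R, 1 <= beta & forall p r, S p -> 0 < r <= diam S ->
    exists2 k, C k `&` disc p r !=set0 &
      beta^-1 * r <= diam (C k) <= beta * r.

Definition relative_separation C : Prop :=
  exists2 delta : R, 0 < delta & forall j k, j != k ->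
    delta <= setdist (C j) (C k) / Num.min (diam (C j)) (diam (C k)).

Definition co_fatness D : Prop :=
  exists2 tau : R, 0 < tau & forall k p r, D k p -> 0 < r ->
    ~ (D k `<=` disc p r) ->
    ((tau * r ^+ 2)%:E <= area (D k `&` disc p r))%E.

Definition homogeneous C D : Prop :=
  [/\ roundness D, all_scales C (residual_set D) &
      relative_separation C \/ co_fatness D].

(* Cardinalities are taken in \bar R, an infinite set having cardinality +oo,
   and lne is the logarithm on \bar R. *)
Definition curvature_distribution C (x : R) : \bar R :=
  counting [set k | (diam (C k))^-1 <= x].

Definition max_disjoint_discs S (e : R) : \bar R :=
  ereal_sup [set counting P | P in
    [set P | P `<=` S /\ trivIset P (fun p => disc p e)]].

Definition dim_ubox S : \bar R :=
  limf_esup (fun e => lne (max_disjoint_discs S e) / (ln (1 / e))%:E)%E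
    (at_right (0 : R)).

Definition dim_lbox S : \bar R :=
  limf_einf (fun e => lne (max_disjoint_discs S e) / (ln (1 / e))%:E)%E
    (at_right (0 : R)).

End packing.

(* Main.v *)
Require Import Defs.
From HB Require Import structures.
From mathcomp Require Import all_boot all_order all_algebra.
From mathcomp Require Import finmap.
From mathcomp Require Import all_classical all_reals all_analysis.
From mathcomp Require Import ring lra.

Set Implicit Arguments.
Unset Strict Implicit.
Unset Printing Implicit Defensive.

Import Order.TTheory GRing.Theory Num.Theory.
Import numFieldNormedType.Exports.

Local Open Scope classical_set_scope.
Local Open Scope ring_scope.

(* Put x = 1/e.  Each of N(x) and n(e) is bounded by a constant multiple of the
   other, up to a dilation of the argument, and neither the constant nor the
   dilation survives the division of the logarithms by ln x.
   For n by N: condition (B) assigns to the centre of each disc a curve of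
   comparable size that meets the disc, and a curve is assigned to boundedly
   many centres because the centres are e-separated.
   For N by n: under (C), points chosen on the curves are centres of disjoint
   discs; under (D), choose a maximal family of disjoint discs of radius e, so
   that every curve passes near one of the centres, and bound the number of
   regions near a centre by comparing areas.
   Both use that C_k lies in the closure of D_k, so that C_k is in the residual
   set for k >= 1 and D_k is not smaller than C_k.  If a point of C_k were not
   in the closure of D_k, the boundary of D_k would lie in an arc, on which the
   argument of x - p, with p in D_k, has a continuous branch; by Tietze it
   extends to the plane, and x - p on the boundary of a large disc would extend
   to a nonvanishing map on the whole disc, whose argument can be lifted. *)

(** * Upper and lower limits of logarithmic ratios *)

Section limits.
Local Open Scope ereal_scope.

Lemma lte_dense (R : realFieldType) (a b : \bar R) : a < b ->
  exists r : R, a < r%:E < b.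
Proof.
move: a b => [a| |] [b| |] //=.
- rewrite lte_fin => ab; exists ((a + b) / 2)%R; rewrite !lte_fin.
  by apply/andP; split; lra.
- move=> _; exists (a + 1)%R; rewrite ltry lte_fin andbT; lra.
- move=> _; exists (b - 1)%R; rewrite ltNyr lte_fin /=; lra.
- by move=> _; exists 0%R; rewrite ltNyr ltry.
Qed.

Lemma lee_edivrMr (R : realFieldType) (r : R) (x y : \bar R) : (0 < r)%R ->
  (y / r%:E <= x) = (y <= x * r%:E).
Proof. by move=> r0; rewrite inver gt_eqF// lee_pdivrMr. Qed.

Lemma lee_edivlMr (R : realFieldType) (r : R) (x y : \bar R) : (0 < r)%R ->
  (x <= y / r%:E) = (x * r%:E <= y).
Proof. by move=> r0; rewrite inver gt_eqF// lee_pdivlMr. Qed.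

(** If the inequality failed, two reals [t < s] would fit strictly between the upper limits, yet
    membership in [F] of the set where [f] is at most [s] bounds the upper limit of [f] by [s]. The
    gap between [t] and [s] absorbs lower-order terms, and having two filters allows a change of
    variable. *)
Lemma le_limf_esup (T1 T2 : choiceType) (X1 : filteredType T1)
    (X2 : filteredType T2) (R : realType) (f : X1 -> \bar R) (g : X2 -> \bar R)
    (F : set_system X1) (G : set_system X2) : Filter G ->
  (forall t s : R, (t < s)%R ->
    G [set y | g y <= t%:E] -> F [set x | f x <= s%:E]) ->
  limf_esup f F <= limf_esup g G.
Proof.
move=> GG fg; rewrite [leRHS]limf_esupE; apply: le_ereal_inf_tmp => _ [V GV <-].
rewrite leNgt; apply/negP => /lte_dense[s /andP[Vs sf]].
have [t /andP[Vt ts]] := lte_dense Vs.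
have : F [set x | f x <= s%:E].
  apply: (fg t); first by rewrite -lte_fin.
  apply: filterS GV => y Vy /=; apply: le_trans (ltW Vt).
  by apply: ereal_sup_ubound; exists y.
move=> Fs; move: sf; rewrite ltNge => /negP; apply.
apply: (@le_trans _ _ (ereal_sup (f @` [set x | f x <= s%:E]))).
  by apply: ereal_inf_lbound; exists [set x | f x <= s%:E].
by apply: ge_ereal_sup => _ [x /= fx <-].
Qed.

Lemma le_limf_einf (T1 T2 : choiceType) (X1 : filteredType T1)
    (X2 : filteredType T2) (R : realType) (f : X1 -> \bar R) (g : X2 -> \bar R)
    (F : set_system X1) (G : set_system X2) : Filter F ->
  (forall t s : R, (s < t)%R ->
    F [set x | t%:E <= f x] -> G [set y | s%:E <= g y]) ->
  limf_einf f F <= limf_einf g G.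
Proof.
move=> FF fg; rewrite /limf_einf leeN2; apply: le_limf_esup => t s ts.
move=> Ft; have := fg (- t)%R (- s)%R; rewrite ltrN2 => /(_ ts) H.
have : G [set y | (- s)%:E <= g y].
  by apply: H; move: Ft; congr F; apply/seteqP; split=> x /=;
    rewrite leeNl.
by congr G; apply/seteqP; split=> x /=; rewrite leeNl.
Qed.

Lemma near_at_rightV (R : realType) (P : set R) :
  (\forall e \near (0^'+)%R, P e^-1%R) <-> (\forall x \near +oo%R, P x).
Proof.
split=> [[d /= d0 dP]|[M [_ MP]]].
  exists d^-1%R; split; first exact: num_real.
  move=> x dx; have x0 : (0 < x)%R by rewrite (lt_trans _ dx)// invr_gt0.
  rewrite -[x]invrK; apply: dP; rewrite ?invr_gt0//=.
  by rewrite sub0r normrN gtr0_norm ?invr_gt0// invf_plt.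
exists ((Num.max M 1)^-1)%R => /=.
  by rewrite invr_gt0 lt_max ltr01 orbT.
move=> e /= + e0; rewrite sub0r normrN gtr0_norm// => eM.
apply: MP; move: eM; rewrite invf_pgt ?posrE//; last first.
  by rewrite lt_max ltr01 orbT.
by rewrite gt_max => /andP[].
Qed.

Lemma limf_esup_at_rightV (R : realType) (f : R -> \bar R) :
  limf_esup (fun e : R => f e^-1%R) (0^'+)%R = limf_esup f (pinfty_nbhs R).
Proof.
apply/eqP; rewrite eq_le; apply/andP; split; apply: le_limf_esup => t s ts.
- move=> fs; apply/(near_at_rightV (fun x => f x <= s%:E));
  apply: filterS fs => x /= /le_trans; apply.
  by rewrite lee_fin ltW.
- move=> /(near_at_rightV (fun x => f x <= t%:E)) fs;
  apply: filterS fs => x /= /le_trans; apply.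
  by rewrite lee_fin ltW.
Qed.

Lemma limf_einf_at_rightV (R : realType) (f : R -> \bar R) :
  limf_einf (fun e : R => f e^-1%R) (0^'+)%R = limf_einf f (pinfty_nbhs R).
Proof.
rewrite /limf_einf; congr (- _).
exact: (limf_esup_at_rightV (fun x => - f x)).
Qed.

Lemma ln_near_pinfty (R : realType) (M : R) :
  \forall x \near +oo%R, (M < ln x)%R.
Proof.
exists (expR M); split; first exact: num_real.
move=> x Mx; rewrite -ltr_expR lnK// posrE.
exact: lt_trans (expR_gt0 _) Mx.
Qed.

Lemma near_pinfty_mul (R : realType) (a : R) (P : set R) : (0 < a)%R ->
  (\forall x \near +oo%R, P x) -> \forall x \near +oo%R, P (a * x)%R.
Proof.
move=> a0 [M [_ MP]]; exists (a^-1 * M)%R; split; first exact: num_real.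
by move=> x ax; apply: MP; rewrite -ltr_pdivrMl.
Qed.

(* The additive constant [c] and the dilation [a] both vanish after division
   by [ln x]. *)
Section log_rate.
Variables (R : realType) (f g : R -> \bar R) (a c : R).
Hypothesis a0 : (0 < a)%R.
Hypothesis fg : \forall x \near +oo%R, f x <= c%:E + g (a * x)%R.

Lemma limf_esup_log_rate :
  limf_esup (fun x => f x / (ln x)%:E) (pinfty_nbhs R) <=
  limf_esup (fun x => g x / (ln x)%:E) (pinfty_nbhs R).
Proof.
apply: le_limf_esup => t s ts gt.
near=> x => /=.
have x0 : (0 < x)%R by near: x; exact: nbhs_pinfty_gt.
have lnx : (0 < ln x)%R by near: x; exact: ln_near_pinfty.
have lnax : (0 < ln (a * x))%R.
  near: x; apply: (near_pinfty_mul (P := fun y => (0 < ln y)%R)) => //.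
  exact: ln_near_pinfty.
have gax : g (a * x)%R / (ln (a * x))%:E <= t%:E.
  by near: x; exact: (near_pinfty_mul (P := fun y => g y / (ln y)%:E <= t%:E)).
have fx : f x <= c%:E + g (a * x)%R by near: x.
rewrite lee_edivrMr//; apply: (le_trans fx).
move: gax; rewrite lee_edivrMr// => gax.
apply: (@le_trans _ _ (c%:E + t%:E * (ln (a * x))%:E)); first by rewrite leeD2l.
rewrite -!EFinM -EFinD lee_fin lnM ?posrE//.
(* The goal [c + t * (ln a + ln x) <= s * ln x] is linear in [ln x]; since [t < s], it holds beyond
   this threshold. *)
have : ((c + t * ln a) / (s - t) < ln x)%R by near: x; exact: ln_near_pinfty.
rewrite ltr_pdivrMr ?subr_gt0//; lra.
Unshelve. all: by end_near. Qed.

Lemma limf_einf_log_rate :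
  limf_einf (fun x => f x / (ln x)%:E) (pinfty_nbhs R) <=
  limf_einf (fun x => g x / (ln x)%:E) (pinfty_nbhs R).
Proof.
apply: le_limf_einf => t s st ft.
have ai : (0 < a^-1)%R by rewrite invr_gt0.
near=> x => /=.
have x0 : (0 < x)%R by near: x; exact: nbhs_pinfty_gt.
have lnx : (0 < ln x)%R by near: x; exact: ln_near_pinfty.
have lnax : (0 < ln (a^-1 * x))%R.
  near: x; apply: (near_pinfty_mul (P := fun y => (0 < ln y)%R)) => //.
  exact: ln_near_pinfty.
have fax : t%:E <= f (a^-1 * x)%R / (ln (a^-1 * x))%:E.
  by near: x; exact: (near_pinfty_mul (P := fun y => t%:E <= f y / (ln y)%:E)).
(* The known bound is now on [f], so the comparison is used at [a^-1 * x], which puts [g] at [x]. *)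
have fx : f (a^-1 * x)%R <= c%:E + g x.
  near: x; have := near_pinfty_mul ai fg.
  by apply: filterS => y; rewrite mulVKf ?gt_eqF.
rewrite lee_edivlMr//.
have : t%:E * (ln (a^-1 * x))%:E <= c%:E + g x.
  by apply: le_trans fx; rewrite -lee_edivlMr.
rewrite -leeBlDl// => /(le_trans _); apply.
rewrite -!EFinM -EFinB lee_fin lnM ?posrE// lnV ?posrE//.
have : ((c + t * ln a) / (t - s) < ln x)%R by near: x; exact: ln_near_pinfty.
rewrite ltr_pdivrMr ?subr_gt0//; lra.
Unshelve. all: by end_near. Qed.

End log_rate.

Lemma le_lne (R : realType) (x y : \bar R) : x <= y -> lne x <= lne y.
Proof.
move=> xy; have [x0|x0] := leP x 0; first by rewrite le0_lneNy ?leNye.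
by rewrite lee_lne// in_itv/= leey andbT ltW// (lt_le_trans x0).
Qed.

Lemma lne_le_mul (R : realType) (K : R) (x y : \bar R) : (0 < K)%R ->
  x <= K%:E * y -> lne x <= (ln K)%:E + lne y.
Proof.
move=> K0 xKy; apply: (le_trans (le_lne xKy)).
have [y0|y0] := leP y 0.
  by rewrite le0_lneNy ?leNye// pmule_rle0 ?lte_fin.
by rewrite lneM ?lne_EFin ?in_itv/= ?lte_fin ?K0 ?y0 ?leey.
Qed.

End limits.

(** * The Euclidean distance *)

Section eucl_dist_theory.
Variable R : realType.
Implicit Types (p q s : R * R) (r : R).

Lemma eucl_dist_ge0 p q : 0 <= eucl_dist p q.
Proof. exact: sqrtr_ge0. Qed.

Lemma eucl_dist_sqr p q :
  eucl_dist p q ^+ 2 = (p.1 - q.1) ^+ 2 + (p.2 - q.2) ^+ 2.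
Proof. by rewrite sqr_sqrtr// addr_ge0 ?sqr_ge0. Qed.

Lemma eucl_distC p q : eucl_dist p q = eucl_dist q p.
Proof. by congr Num.sqrt; ring. Qed.

Lemma eucl_distxx p : eucl_dist p p = 0.
Proof. by rewrite /eucl_dist !subrr expr0n/= addr0 sqrtr0. Qed.

Lemma eucl_dist_le p q r : 0 <= r ->
  (eucl_dist p q <= r) = ((p.1 - q.1) ^+ 2 + (p.2 - q.2) ^+ 2 <= r ^+ 2).
Proof.
by move=> r0; rewrite -eucl_dist_sqr ler_pXn2r ?nnegrE ?eucl_dist_ge0.
Qed.

Lemma eucl_dist_triangle s p q :
  eucl_dist p q <= eucl_dist p s + eucl_dist s q.
Proof.
have A0 := eucl_dist_ge0 p s; have B0 := eucl_dist_ge0 s q.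
rewrite eucl_dist_le ?addr_ge0//.
have := eucl_dist_sqr p s; have := eucl_dist_sqr s q.
move: (eucl_dist p s) (eucl_dist s q) A0 B0 => A B A0 B0.
rewrite (_ : p.1 - q.1 = (p.1 - s.1) + (s.1 - q.1)); last by ring.
rewrite (_ : p.2 - q.2 = (p.2 - s.2) + (s.2 - q.2)); last by ring.
move: (p.1 - s.1) (p.2 - s.2) (s.1 - q.1) (s.2 - q.2) => a b c d Be Ae.
suff : a * c + b * d <= A * B by lra.
rewrite (le_trans (ler_norm _))// -[leRHS]ger0_norm ?mulr_ge0//.
rewrite -ler_sqr ?nnegrE// !real_normK ?num_real// exprMn Ae Be.
by have := sqr_ge0 (a * d - b * c); lra.
Qed.

Lemma eucl_dist_fst p q : `|p.1 - q.1| <= eucl_dist p q.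
Proof.
rewrite -ler_sqr ?nnegrE ?eucl_dist_ge0// eucl_dist_sqr real_normK ?num_real//.
by rewrite lerDl sqr_ge0.
Qed.

Lemma eucl_dist_snd p q : `|p.2 - q.2| <= eucl_dist p q.
Proof.
rewrite -ler_sqr ?nnegrE ?eucl_dist_ge0// eucl_dist_sqr real_normK ?num_real//.
by rewrite lerDr sqr_ge0.
Qed.

Lemma eucl_dist_leD p q : eucl_dist p q <= `|p.1 - q.1| + `|p.2 - q.2|.
Proof.
rewrite eucl_dist_le ?addr_ge0// -[in leLHS]real_normK ?num_real//.
rewrite -[X in _ + X <= _]real_normK ?num_real// sqrrD addrAC.
by rewrite lerDl mulrn_wge0// mulr_ge0.
Qed.

Lemma norm_le_eucl_dist p q : `|p - q| <= eucl_dist p q.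
Proof. by rewrite prod_normE /= ge_max eucl_dist_fst eucl_dist_snd. Qed.

Lemma eucl_dist_le_norm p q : eucl_dist p q <= 2 * `|p - q|.
Proof.
apply: (le_trans (eucl_dist_leD p q)).
rewrite mulr_natl mulr2n lerD// prod_normE le_max /= lexx ?orbT//.
Qed.

Lemma disc_center p r : 0 < r -> disc p r p.
Proof. by rewrite /disc/= eucl_distxx. Qed.

Lemma eucl_dist_gt0 p q : p <> q -> 0 < eucl_dist p q.
Proof.
move=> pq; rewrite (lt_le_trans _ (norm_le_eucl_dist p q))// normr_gt0 subr_eq0.
exact/eqP.
Qed.

Lemma continuous_eucl_dist p : continuous (eucl_dist p).
Proof.
move=> q; apply: (@cvg_comp _ _ _ _ Num.sqrt); last exact: sqrt_continuous.
apply: cvgD; apply: cvgM; apply: cvgB;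
  by [exact: cvg_cst|exact: cvg_fst|exact: cvg_snd].
Qed.

Lemma open_disc p r : open (disc p r).
Proof.
rewrite (_ : disc p r = eucl_dist p @^-1` `]-oo, r[); last first.
  by apply/seteqP; split=> q /=; rewrite in_itv.
by apply: open_comp => [q _|]; [exact: continuous_eucl_dist|exact: interval_open].
Qed.

Lemma closure_eucl_dist_le p r (A : set (R * R)) :
  (forall q, A q -> eucl_dist p q <= r) -> forall q, closure A q -> eucl_dist p q <= r.
Proof.
move=> Ar; suff /closure_id cl : closed [set q | eucl_dist p q <= r].
  by have := closure_subset Ar; rewrite -cl.
rewrite (_ : [set q | _] = eucl_dist p @^-1` `]-oo, r]); last first.
  by apply/seteqP; split=> q /=; rewrite in_itv.
apply: closed_comp => [q _|]; first exact: continuous_eucl_dist.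
exact: interval_closed.
Qed.

Lemma has_sup_dist (A : set (R * R)) : A !=set0 -> bounded_set A ->
  has_sup [set eucl_dist p q | p in A & q in A].
Proof.
move=> [p Ap] [M [_ AM]]; split; first by exists (eucl_dist p p), p => //; exists p.
exists (2 * ((M + 1) + (M + 1))) => _ [x Ax [y Ay <-]].
apply: (le_trans (eucl_dist_le_norm _ _)); rewrite ler_pM2l//.
by rewrite (le_trans (ler_normB _ _))// lerD// AM// ltrDl.
Qed.

Lemma diam_ge (A : set (R * R)) p q : bounded_set A -> A p -> A q ->
  eucl_dist p q <= diam A.
Proof.
move=> bA Ap Aq; apply: ub_le_sup; last by exists p => //; exists q.
by have [] := has_sup_dist (ex_intro _ _ Ap) bA.
Qed.

Lemma diam_le (A : set (R * R)) r : 0 <= r ->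
  (forall p q, A p -> A q -> eucl_dist p q <= r) -> diam A <= r.
Proof.
move=> r0 Ar; rewrite /diam.
set E := [set _ | _ in _ & _ in _]; have [->|/set0P E0] := eqVneq E set0.
  by rewrite sup0.
by apply: ge_sup => // _ [p Ap [q Aq <-]]; exact: Ar.
Qed.

End eucl_dist_theory.

(** * Counting *)

(** An infinite set has finite subsets of every size, so a uniform bound on finite subsets forces
    finiteness. *)
Lemma counting_le_fset (R : realType) (T : choiceType) (A : set T) (n : nat) :
  (forall X : {fset T}, [set` X] `<=` A -> (#|` X| <= n)%N) ->
  (counting A <= n%:R%:E :> \bar R)%E.
Proof.
move=> An; have [Af|/(infinite_set_fset n.+1)[X XA nX]] := pselect (finite_set A).
  rewrite /counting asboolT// lee_fin ler_nat; apply: An => x /=.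
  by rewrite in_fset_set// inE.
by have := leq_trans nX (An _ XA); rewrite ltnn.
Qed.

(** Double counting: each [x] contributes one pair [(x, f x)], and the pairs are then summed by
    their second entry. With [m] positive, the right-hand side stays infinite when [B] is
    infinite. *)
Lemma counting_le_fiber (R : realType) (T U : choiceType) (A : set T)
    (B : set U) (f : T -> U) (m : nat) : (0 < m)%N ->
  (forall x, A x -> B (f x)) ->
  (forall u (X : {fset T}), B u -> [set` X] `<=` A `&` f @^-1` [set u] ->
    (#|` X| <= m)%N) ->
  (counting A <= m%:R%:E * counting B :> \bar R)%E.
Proof.
move=> m0 AB fm; have [Bf|Binf] := pselect (finite_set B); last first.
  by rewrite [leRHS](_ : _ = +oo%E) ?leey// /counting asboolF// gt0_muley// lte_fin ltr0n.
rewrite [in leRHS]/counting asboolT// -EFinM -natrM.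
apply: counting_le_fset => X XA.
rewrite -sum1_size.
have XB x : x \in X -> (\sum_(u <- fset_set B) nat_of_bool (f x == u))%N = 1%N.
  move=> xX; rewrite (bigD1_seq (f x)) ?fset_uniq//=; last first.
    by rewrite in_fset_set// inE; apply/AB/XA.
  by rewrite eqxx big1// => u; rewrite eq_sym => /negbTE ->.
rewrite (eq_big_seq (fun x => (\sum_(u <- fset_set B) nat_of_bool (f x == u))%N)); last first.
  by move=> x /XB ->.
rewrite exchange_big/= mulnC -[X in (_ <= X * _)%N]sum1_size big_distrl/=.
rewrite big_seq [leqRHS]big_seq; apply: leq_sum => u.
rewrite in_fset_set// inE mul1n => Bu.
rewrite -big_mkcond sum1_count -size_filter.
set s := [seq _ <- _ | _]; have us : uniq s by rewrite filter_uniq// fset_uniq.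
have := fm u [fset x in s]%fset Bu.
rewrite card_fseq undup_id //; apply=> x /=.
rewrite inE mem_filter => /andP[/eqP <- xX]; split => //.
exact: XA.
Qed.

(** Pigeonhole on a grid of mesh [e / 2]: the square of half-side [L * e] about [c] needs
    [4 * L + 1] cells per axis, and two points in one cell differ by less than [e / 2] in each
    coordinate, hence are less than [e] apart. The bound does not depend on [e]. *)
Lemma separated_card_le (R : realType) (L : nat) :
  exists2 m : nat, (0 < m)%N & forall (e : R) (c : R * R) (X : {fset R * R}),
    0 < e ->
    (forall p, p \in X -> eucl_dist p c <= L%:R * e) ->
    (forall p q, p \in X -> q \in X ->
      p <> q -> e <= eucl_dist p q) ->
    (#|` X| <= m)%N.
Proof.
pose N := (4 * L).+1; exists (N * N)%N => // e c X e0 Xc sX.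
pose cell (a b : R) : 'I_N := inord (Num.truncn ((a - b) / e * 2 + (2 * L)%:R)).
have cellP (a b : R) : `|a - b| <= L%:R * e ->
    (cell a b)%:R * e <= (a - b) * 2 + (2 * L)%:R * e < ((cell a b)%:R + 1) * e.
  move=> /ler_normlP[ab1 ab2].
  have -> : (a - b) * 2 + (2 * L)%:R * e = ((a - b) / e * 2 + (2 * L)%:R) * e.
    by field; rewrite gt_eqF.
  rewrite ler_pM2r// ltr_pM2r//.
  have abe : `|(a - b) / e| <= L%:R.
    rewrite normrM normfV (gtr0_norm e0) ler_pdivrMr// ler_norml.
    by apply/andP; split; lra.
  move: abe => /ler_normlP[abe1 abe2].
  have v0 : 0 <= (a - b) / e * 2 + (2 * L)%:R by rewrite natrM; lra.
  rewrite /cell inordK ?natr1; first exact: truncn_itv.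
  by rewrite truncn_lt_nat// /N -natr1 !natrM; lra.
rewrite -[(N * N)%N](_ : #|[the finType of ('I_N * 'I_N)%type]| = _); last first.
  by rewrite card_prod card_ord.
rewrite cardT -(size_map (fun p : R * R => (cell p.1 c.1, cell p.2 c.2))).
apply: uniq_leq_size; last by move=> x; rewrite mem_enum.
rewrite map_inj_in_uniq ?fset_uniq// => p q pX qX [] pq1 pq2.
apply/eqP/negPn/negP => /eqP /(sX _ _ pX qX); apply/negP; rewrite -ltNge.
have Pc1 := cellP _ _ (le_trans (eucl_dist_fst p c) (Xc _ pX)).
have Pc2 := cellP _ _ (le_trans (eucl_dist_snd p c) (Xc _ pX)).
have := cellP _ _ (le_trans (eucl_dist_fst q c) (Xc _ qX)).
have := cellP _ _ (le_trans (eucl_dist_snd q c) (Xc _ qX)).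
rewrite -pq1 -pq2 => /andP[q2 q2'] /andP[q1 q1'].
move: Pc1 Pc2 => /andP[p1 p1'] /andP[p2 p2'].
apply: (le_lt_trans (eucl_dist_leD p q)).
have h1 : `|p.1 - q.1| < e / 2 by rewrite ltr_norml; apply/andP; split; lra.
have h2 : `|p.2 - q.2| < e / 2 by rewrite ltr_norml; apply/andP; split; lra.
lra.
Qed.

(** * Lifting of circle-valued maps *)

Section lifting.
Variable R : realType.

Definition circle (t : R) : R * R := (cos t, sin t).

Lemma circle_onto (a : R * R) : a.1 ^+ 2 + a.2 ^+ 2 = 1 ->
  exists t, a = circle t.
Proof.
move=> a1.
have a1b : -1 <= a.1 <= 1.
  rewrite -ler_norml -[leRHS](@normr1 R) -ler_sqr ?nnegrE// !real_normK ?num_real//.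
  by rewrite expr1n; have := sqr_ge0 a.2; lra.
have a2E : `|a.2| = sin (acos a.1).
  by rewrite sin_acos// -a1 addrAC subrr add0r sqrtr_sqr.
have cE : cos (acos a.1) = a.1 by rewrite acosK// in_itv.
have [a20|a20] := leP 0 a.2.
  exists (acos a.1); rewrite /circle cE -a2E ger0_norm//; by case: (a).
exists (- acos a.1); rewrite /circle cosN sinN cE -a2E ltr0_norm// opprK.
by case: (a).
Qed.

(* Meaningful for unit vectors less than a right angle apart. *)
Definition angle (a b : R * R) : R :=
  atan ((a.2 * b.1 - a.1 * b.2) / (a.1 * b.1 + a.2 * b.2)).

(** The numerator and denominator in [angle] are the sine and cosine of the angle from [circle t] to
    [a]; when the cosine is positive, the arctangent of their quotient recovers that angle. *)
Lemma circleD_angle (a : R * R) (t : R) : a.1 ^+ 2 + a.2 ^+ 2 = 1 ->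
  0 < a.1 * cos t + a.2 * sin t -> circle (t + angle a (circle t)) = a.
Proof.
move=> a1; rewrite /angle/=.
set d := a.1 * _ + _ => d0; set c := a.2 * _ - _.
have dc : d ^+ 2 + c ^+ 2 = 1.
  have := cos2Dsin2 t; rewrite /d /c => cs.
  rewrite (_ : _ + _ = (a.1 ^+ 2 + a.2 ^+ 2) * (cos t ^+ 2 + sin t ^+ 2)).
    by rewrite a1 cs mulr1.
  by ring.
have cosE : cos (atan (c / d)) = d.
  rewrite cos_atan (_ : 1 + _ = d^-1 ^+ 2).
    by rewrite sqrtr_sqr gtr0_norm ?invr_gt0// invrK.
  rewrite -[RHS]mul1r -[in RHS]dc; field; exact: lt0r_neq0.
have sinE : sin (atan (c / d)) = c.
  have : tan (atan (c / d)) = c / d by rewrite atanK.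
  rewrite /tan cosE => /(congr1 (fun x => x * d)); rewrite !divfK ?gt_eqF//.
rewrite /circle cosD sinD cosE sinE /d /c.
have cs := cos2Dsin2 t.
case: (a) => x y /=; congr pair.
  rewrite (_ : _ - _ = x * (cos t ^+ 2 + sin t ^+ 2)); last by ring.
  by rewrite cs mulr1.
rewrite (_ : _ + _ = y * (cos t ^+ 2 + sin t ^+ 2)); last by ring.
by rewrite cs mulr1.
Qed.

(** For unit vectors the squared Euclidean distance is 2 minus twice the dot product, and a sup-norm
    distance below 1 makes it smaller than 2. *)
Lemma dot_gt0 (a b : R * R) : a.1 ^+ 2 + a.2 ^+ 2 = 1 ->
  b.1 ^+ 2 + b.2 ^+ 2 = 1 -> `|a - b| < 1 -> 0 < a.1 * b.1 + a.2 * b.2.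
Proof.
move=> a1 b1; rewrite prod_normE gt_max /= => /andP[].
rewrite -ltr_sqr ?nnegrE// real_normK ?num_real// expr1n => h1.
rewrite -ltr_sqr ?nnegrE// real_normK ?num_real// expr1n => h2.
lra.
Qed.

(** Only [x] is confined to [K]: the covering balls are neighbourhoods in the whole space, so [y]
    may leave [K]. *)
Lemma compact_uniform_continuous (V W : normedModType R) (f : V -> W) (K : set V)
  (e : R) : continuous f -> compact K -> 0 < e ->
  exists2 d, 0 < d & forall x y, K x -> `|x - y| < d -> `|f x - f y| < e.
Proof.
move=> cf /compact_near_coveringP cK e0.
have : \forall d \near 0^'+, K `<=` [set x | forall y, `|x - y| < d -> `|f x - f y| < e].
  apply: cK => x Kx.
  have : \forall z \near x, `|f x - f z| < e / 2.
    by apply: (@cvgr_dist_lt _ _ _ _ _ f _ (cf x)); rewrite divr_gt0.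
  move=> /nbhs_ballP[r /= r0 xr].
  (* Halving the radius keeps every point within [d] of the smaller ball inside [ball x r]. *)
  exists (ball x (r / 2), [set d | 0 < d < r / 2]); [split|] => /=.
  - by apply: nbhsx_ballx; rewrite divr_gt0.
  - near=> d; apply/andP; split; first by near: d; exact: nbhs_right_gt.
    by near: d; apply: nbhs_right_lt; rewrite divr_gt0.
  - move=> [z d] /= [xz /andP[d0 dr]] y zy.
    have rz : ball x r z by apply: le_ball xz; rewrite ler_pdivrMr// ler_peMr ?ler1n// ltW.
    have ry : ball x r y.
      move: xz; rewrite -!ball_normE /= => xz.
      rewrite (_ : x - y = (x - z) + (z - y)); last by rewrite addrA subrK.
      rewrite (le_lt_trans (ler_normD _ _))// [ltRHS]splitr ltrD// (lt_trans zy)//.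
    have := xr _ rz; have := xr _ ry.
    rewrite /= => h1 h2.
    rewrite (_ : f z - f y = (f z - f x) + (f x - f y)); last by rewrite addrA subrK.
    rewrite (le_lt_trans (ler_normD _ _))// [ltRHS]splitr ltrD// distrC//.
move=> H; have [d [dK d0]] := filter_ex (filterI H (nbhs_right_gt 0)).
by exists d => // x y Kx; exact: dK.
Unshelve. all: by end_near. Qed.

(* By compactness, [f] turns by less than a right angle between consecutive
   points of a fine enough subdivision of each segment from [x0], so that the
   successive angles can be added up. *)
Lemma circle_lift (V : normedModType R) (f : V -> R * R) (K : set V) (x0 : V) :
  continuous f -> (forall x, (f x).1 ^+ 2 + (f x).2 ^+ 2 = 1) ->
  compact K ->
  (forall x (t : R), K x -> 0 <= t <= 1 -> K (x0 + t *: (x - x0))) ->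
  exists theta : V -> R, (forall x, K x -> {for x, continuous theta}) /\
    forall x, K x -> f x = circle (theta x).
Proof.
move=> cf f1 cK sK.
have [d d0 dK] := compact_uniform_continuous cf cK ltr01.
have [M M0 KM] : exists2 M : R, 0 < M & forall x, K x -> `|x - x0| <= M.
  have [M [_ KM]] := compact_bounded cK.
  exists (`|M| + 1 + `|x0|); first by rewrite ltr_wpDr// ltr_wpDl.
  move=> x Kx; rewrite (le_trans (ler_normB _ _))// lerD2r KM//.
  by rewrite (le_lt_trans (ler_norm M))// ltrDl.
(* With [n] steps, consecutive subdivision points of a segment from [x0] to a point of [K] are at
   most [M / n < d] apart. *)
pose n := (Num.truncn (M / d)).+1.
have nM : M / n%:R < d.
  by rewrite ltr_pdivrMr// mulrC -ltr_pdivrMr// truncnS_gt.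
pose pt i x := x0 + (i%:R / n%:R) *: (x - x0).
have cpt i : continuous (pt i).
  move=> x; apply: cvgD; first exact: cvg_cst.
  by apply: cvgZr; apply: cvgB; [exact: cvg_id|exact: cvg_cst].
have Kpt i x : K x -> (i <= n)%N -> K (pt i x).
  move=> Kx ni; apply: sK => //; rewrite divr_ge0//= ler_pdivrMr ?ltr0n//.
  by rewrite mul1r ler_nat.
have dot i x : K x -> (i < n)%N ->
    0 < (f (pt i.+1 x)).1 * (f (pt i x)).1 + (f (pt i.+1 x)).2 * (f (pt i x)).2.
  move=> Kx ni; apply: dot_gt0 => //; apply: dK; first exact: Kpt.
  rewrite /pt opprD addrACA subrr add0r -scalerBl normrZ -mulrBl -natr1.
  rewrite addrAC subrr add0r mul1r normfV gtr0_norm ?ltr0n// mulrC.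
  by rewrite (le_lt_trans _ nM)// ler_pM2r ?invr_gt0 ?ltr0n// KM.
have [t0 ft0] := circle_onto (f1 x0).
pose theta k x := t0 + \sum_(i < k) angle (f (pt i.+1 x)) (f (pt i x)).
exists (theta n); split.
  move=> x Kx; apply: cvgD; first exact: cvg_cst.
  apply: (@cvg_big _ _ _ _ _ (@add_continuous _)) => i _.
  have c j : f (pt j z) @[z --> x] --> f (pt j x).
    by apply: continuous_comp; [exact: cpt|exact: cf].
  have c1 j : (f (pt j z)).1 @[z --> x] --> (f (pt j x)).1.
    exact: (cvg_comp (fun z => f (pt j z)) fst (c j) cvg_fst).
  have c2 j : (f (pt j z)).2 @[z --> x] --> (f (pt j x)).2.
    exact: (cvg_comp (fun z => f (pt j z)) snd (c j) cvg_snd).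
  apply: continuous_comp; last exact: continuous_atan.
  apply: cvgM; first by apply: cvgB; apply: cvgM.
  apply: cvgV; first by rewrite gt_eqF// dot.
  by apply: cvgD; apply: cvgM.
move=> x Kx.
(* The partial sums lift [f] at the successive subdivision points; the last one, [pt n x], is
   [x]. *)
have H k : (k <= n)%N -> f (pt k x) = circle (theta k x).
  elim: k => [_|k IH kn]; first by rewrite /pt mul0r scale0r addr0 /theta big_ord0 addr0.
  rewrite /theta big_ord_recr/= addrA -/(theta k x) IH 1?ltnW//.
  by rewrite circleD_angle//; have := dot k x Kx kn; rewrite (IH (ltnW kn)).
by rewrite -H// /pt divff ?pnatr_eq0// scale1r addrC subrK.
Qed.

End lifting.

(** * Closed curves and their bounded complementary components *)

Section plane_topology.
Variable R : realType.

(** Precomposing with a retraction of the line onto the segment trades continuity within the segment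
    for continuity everywhere, and adds no new values. *)
Lemma continuous_extend_segment (T : topologicalType) (g : R -> T) :
  {within `[0, 1], continuous g} ->
  exists h : R -> T, [/\ continuous h, {in `[0, 1], g =1 h} &
    forall s, (g @` `[0, 1]) (h s)].
Proof.
move=> cg.
(* the nearest-point projection onto the segment *)
pose clamp (s : R) := (`|s| - `|s - 1| + 1) / 2.
have cc : continuous clamp.
  move=> s; apply: cvgM; last exact: cvg_cst.
  apply: cvgD; last exact: cvg_cst.
  apply: cvgB; first exact: norm_continuous.
  apply: (@cvg_norm _ _ _ _ _ (fun z : R => z - 1) (s - 1)).
  by apply: cvgB; [exact: cvg_id|exact: cvg_cst].
have c01 s : `[0, 1]%classic (clamp s).
  rewrite /= in_itv/= /clamp; have [s0|s0] := leP 0 s; have [s1|s1] := leP 0 (s - 1).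
  - by rewrite ?ger0_norm// ; apply/andP; split; lra.
  - by rewrite (ger0_norm s0) (ltr0_norm s1); apply/andP; split; lra.
  - lra.
  - by rewrite (ltr0_norm s0) (ltr0_norm s1); apply/andP; split; lra.
exists (g \o clamp); split; last by move=> s; exists (clamp s).
  2:{
  move=> s; rewrite in_itv/= => /andP[s0 s1]; congr g; rewrite /clamp.
  by rewrite ger0_norm// ler0_norm ?subr_le0//; lra. }
apply/continuous_closedP => W cW.
have /continuous_closedP/(_ _ cW)/closed_subspaceP[V cV VW] := cg.
rewrite (_ : _ @^-1` W = clamp @^-1` V).
  by apply: closed_comp => // s _; exact: cc.
have VWs s : V (clamp s) <-> W (g (clamp s)).
  split=> h.
    have : (V `&` `[0, 1]) (clamp s) by split => //; exact: c01.
    by rewrite VW => -[].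
  have : ((g : subspace `[0, 1] -> T) @^-1` W `&` `[0, 1]) (clamp s).
    by split => //; exact: c01.
  by rewrite -VW => -[].
by apply/seteqP; split=> s /VWs.
Qed.

Lemma connected_ball (V : normedModType R) (x : V) (r : R) : connected (ball x r).
Proof.
rewrite (_ : ball x r = \bigcup_(y in ball x r)
    ((fun t : R => x + t *: (y - x)) @` `[0, 1])).
  apply: bigcup_connected.
    exists x => y _; exists 0; last by rewrite scale0r addr0.
    by rewrite /= in_itv/= lexx ler01.
  move=> y _; apply: connected_continuous_connected; first exact: segment_connected.
  apply: continuous_subspaceT => t; apply: cvgD; first exact: cvg_cst.
  by apply: cvgZl; exact: cvg_id.
apply/seteqP; split=> [y xy|_ [y xy [t /= + <-]]].
  exists y => //; exists 1; first by rewrite /= in_itv/= lexx ler01.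
  by rewrite scale1r addrC subrK.
rewrite in_itv/= => /andP[t0 t1].
move: xy; rewrite -ball_normE /ball_/= opprD addNKr normrN normrZ (ger0_norm t0).
rewrite distrC; apply: le_lt_trans; by rewrite ler_piMl.
Qed.

(** Balls are connected, so a component absorbs every ball inside [A] that it meets. This makes
    components of an open set open, and closed relative to it. *)
Lemma ball_component (V : normedModType R) (A : set V) (p x : V) (r : R) (y : V) :
  ball x r `<=` A -> ball x r y -> connected_component A p y ->
  ball x r `<=` connected_component A p.
Proof.
move=> xA xy py; rewrite (same_connected_component py).
exact: connected_component_max (@connected_ball _ _ _).
Qed.

Lemma open_component (V : normedModType R) (A : set V) (p : V) :
  open A -> open (connected_component A p).
Proof.
rewrite !openE => oA x px; have /nbhs_ballP[r /= r0 xr] := oA _ (connected_component_sub px).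
apply/nbhs_ballP; exists r => //; apply: (ball_component xr _ px).
exact: ballxx.
Qed.

Lemma closure_component (V : normedModType R) (A : set V) (p : V) :
  open A -> closure (connected_component A p) `&` A `<=` connected_component A p.
Proof.
rewrite openE => oA x [clx Ax]; have /nbhs_ballP[r /= r0 xr] := oA _ Ax.
have [y [py xy]] := clx _ (nbhsx_ballx x r r0).
by apply: (ball_component xr xy py); exact: ballxx.
Qed.

(** The difference [theta t - t] drops by [2 * pi] over the period, so it takes the middle value
    [theta 0 - pi]. As [theta 0] is an angle of the point [(1, 0)], at that [t] the points
    [circle t] and [circle (theta t)] are antipodal, so they cannot be equal. *)
Lemma circle_no_lift (theta : R -> R) : {within `[0, 2 * pi], continuous theta} ->
  theta 0 = theta (2 * pi) ->
  ~ (forall t, 0 <= t <= 2 * pi -> circle t = circle (theta t)).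
Proof.
move=> ct th H; pose h t := theta t - t.
have pi0 : 0 < pi :> R := pi_gt0 R.
have [|||t] := @IVT R h 0 (2 * pi) (theta 0 - pi).
- by lra.
- move=> z; apply: cvgB; first exact: ct.
  by apply: continuous_subspaceT => ?; exact: cvg_id.
- rewrite /h -th subr0 le_max ge_min; apply/andP; split; apply/orP; [right|left]; lra.
rewrite in_itv/= => tI ht.
have tE : t = theta t - (theta 0 - pi) by rewrite -ht /h; lra.
have [c0 s0] : cos (theta 0) = 1 /\ sin (theta 0) = 0.
  have : circle 0 = circle (theta 0) by apply: H; lra.
  by rewrite /circle cos0 sin0 => -[<- <-].
have := H _ tI; rewrite /circle => -[cE sE].
have cN : cos t = - cos (theta t).
  rewrite {1}tE opprB addrA addrAC cosDpi cosB c0 s0; lra.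
have sN : sin t = - sin (theta t).
  rewrite {1}tE opprB addrA addrAC sinDpi sinB c0 s0; lra.
have := cos2Dsin2 (theta t).
rewrite (_ : cos _ = 0); last by lra.
rewrite (_ : sin _ = 0); last by lra.
by rewrite !expr0n/= addr0 => /eqP; rewrite eq_sym oner_eq0.
Qed.

End plane_topology.

(** * A continuous argument on a closed proper part of a closed curve *)

Section argument_branch.
Variable R : realType.

(* [g s0] is not in [A], so on [A] the branch obtained along [g] may be shifted
   after time [s0], which makes it agree at the common end point [g 0 = g 1]. *)
Lemma extend_arg (g : R -> R * R) (f : R * R -> R * R) (A : set (R * R)) (s0 : R) :
  continuous g -> g 0 = g 1 -> set_inj `[0, 1[ g ->
  closed A -> A `<=` g @` `[0, 1] -> 0 <= s0 <= 1 -> ~ A (g s0) ->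
  continuous (f \o g) -> (forall s, (f (g s)).1 ^+ 2 + (f (g s)).2 ^+ 2 = 1) ->
  exists2 theta : R * R -> R, continuous theta &
    forall x, A x -> f x = circle (theta x).
Proof.
move=> cg g01 gi cA Ag s01 As0 cfg fg1.
have star (x t : R) : `[0, 1]%classic x -> 0 <= t <= 1 ->
    `[0, 1]%classic (0 + t *: (x - 0)).
  rewrite /= !in_itv/= subr0 add0r => /andP[x0 x1] /andP[t0 t1].
  by rewrite mulr_ge0//= mulr_ile1.
have [th1 [cth1 th1E]] := circle_lift (x0 := 0) cfg fg1 (@segment_compact R 0 1) star.
have [|th [cth thE' _]] := @continuous_extend_segment R R th1.
  by apply: continuous_in_subspaceT => s; rewrite inE => /cth1.
have thE s : 0 <= s <= 1 -> f (g s) = circle (th s).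
  by move=> s1; rewrite -thE' ?in_itv//; apply: th1E; rewrite /= in_itv.
(* Since [g 0 = g 1], this is a period of [circle]. *)
pose c := th 0 - th 1.
have circc t : circle (t + c) = circle t.
  have : circle (th 0) = circle (th 1) by rewrite -!thE ?lexx ?ler01// g01.
  move=> [c01 s01'].
  have cc : cos c = 1 by rewrite /c cosB c01 s01' -!expr2 cos2Dsin2.
  have sc : sin c = 0 by rewrite /c sinB c01 s01' mulrC subrr.
  by rewrite /circle cosD sinD cc sc !mulr1 !mulr0 subr0 addr0.
(* The shift gives [th2 1 = th 1 + c = th 0], so that the values at the two ends agree. *)
pose th2 s := if s < s0 then th s else th s + c.
have th2E s : 0 <= s <= 1 -> f (g s) = circle (th2 s).
  by move=> s1; rewrite /th2; case: ifP => _; rewrite ?circc thE.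
pose K := [set s : R | 0 <= s <= 1 /\ A (g s)].
(* By injectivity on the half-open interval, the only coincidence between distinct parameters is
   that of 0 and 1. *)
have gK s s' : K s -> K s' -> s <= s' -> g s = g s' -> th2 s = th2 s'.
  move=> [/andP[s0' s1] As] [/andP[s0'' s1'] As'] ss gss.
  have [s'1|s'1] := ltP s' 1.
    congr th2; apply: gi => //; rewrite inE/= in_itv/= ?s0' ?s0''//=.
    exact: le_lt_trans ss s'1.
  have {s1' s'1}s'1 : s' = 1 by apply/le_anti; rewrite s1' s'1.
  subst s'; have [s1'|s1'] := ltP s 1; last first.
    by congr th2; apply/le_anti; rewrite s1 s1'.
  have {gss} sE : s = 0.
    by apply: gi; rewrite ?inE/= ?in_itv/= ?lexx ?ltr01 ?s0' ?s1'// g01.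
  subst s; rewrite /th2.
  have -> : 0 < s0.
    by rewrite lt_neqAle (andP s01).1 andbT; apply/eqP => E; apply: As0; rewrite -E.
  rewrite ltNge (andP s01).2 /= /c; lra.
have th2g s s' : K s -> K s' -> g s = g s' -> th2 s = th2 s'.
  by move=> Ks Ks' ss; have [?|/ltW?] := leP s s'; [exact: gK|apply/esym/gK].
have /choice[sg sgP] : forall x, exists s, A x -> K s /\ g s = x.
  move=> x; have [Ax|nAx] := pselect (A x); last by exists 0.
  have [s sI sx] := Ag _ Ax; exists s => _; split => //; split; last by rewrite sx.
  by move: sI; rewrite /= in_itv.
pose tau x := th2 (sg x).
have tauE s : K s -> tau (g s) = th2 s.
  by move=> Ks; have [] := sgP (g s) Ks.2 => ? ?; exact: th2g.
have ctau : {within A, continuous tau}.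
  apply/continuous_closedP => W cW; apply/closed_subspaceP.
  (* The preimage of [W] is the union of the images of two compact sets, one for each side of the
     jump; [s0] itself is in neither, because [g s0] is not in [A]. *)
  pose K1 := `[0, s0] `&` (g @^-1` A `&` th @^-1` W).
  pose K2 := `[s0, 1] `&` (g @^-1` A `&` (fun s => th s + c) @^-1` W).
  have cK1 : compact K1.
    apply: compact_closedI; first exact: segment_compact.
    by apply: closedI; apply: closed_comp => // s _.
  have cK2 : compact K2.
    apply: compact_closedI; first exact: segment_compact.
    apply: closedI; apply: closed_comp => // s _.
    by apply: cvgD; [exact: cth|exact: cvg_cst].
  exists (g @` K1 `|` g @` K2).
    by apply: closedU; apply: compact_closed (@norm_hausdorff _ _) _;
      apply: continuous_compact => //; apply: continuous_subspaceT.
  apply/seteqP; split=> x [].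
    move=> + Ax; move=> [] [s [/=]]; rewrite in_itv/= => /andP[sl sr] [Ags Ws] gsx.
      have ss0 : s < s0.
        rewrite lt_neqAle sr andbT; apply/eqP => E; apply: As0; by rewrite -E.
      have Ks : K s by split => //; rewrite sl (le_trans sr)// (andP s01).2.
      by split => //=; rewrite /from_subspace -gsx tauE// /th2 ss0.
    have Ks : K s by split => //; rewrite sr (le_trans _ sl)// (andP s01).1.
    by split => //=; rewrite /from_subspace -gsx tauE// /th2 ltNge sl.
  rewrite /= /from_subspace => + Ax; rewrite /tau /th2; have [[/andP[sl sr] As] sx] := sgP x Ax.
  case: ltP => [ss|ss] Ws; split => //; [left|right]; exists (sg x) => //.
    by split; rewrite /= ?in_itv/= ?sl ?ltW.
  by split; rewrite /= ?in_itv/= ?sr ?ss.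
(* The Tietze theorem applied below is the one for bounded functions, so a bound on [tau] is
   needed. *)
have [M M0 tauM] : exists2 M, 0 < M & forall x, A x -> `|tau x| <= M.
  have [M [_ thM]] : bounded_set (th @` `[0, 1]).
    apply: compact_bounded; apply: continuous_compact; last exact: segment_compact.
    exact: continuous_subspaceT.
  exists (`|M| + 1 + `|c|); first by rewrite ltr_wpDr// ltr_wpDl.
  move=> x /sgP[[s01' _] _]; rewrite /tau; set s := sg x in s01' *.
  have : `|th s| <= `|M| + 1.
    apply: thM; first by rewrite (le_lt_trans (ler_norm M))// ltrDl.
    by exists s => //; rewrite /= in_itv.
  rewrite /th2; case: ifP => _ ths; first by rewrite ler_wpDr.
  by rewrite (le_trans (ler_normD _ _))// lerD2r.
have [theta [tE ct _]] :=
  continuous_bounded_extension (@pseudometric_normal R _) cA M0 ctau tauM.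
exists theta => // x Ax; have [Ks <-] := sgP x Ax.
rewrite (th2E _ Ks.1) -tE ?inE; last exact: Ks.2.
by rewrite tauE.
Qed.

End argument_branch.

(** * A simple closed curve lies in the closure of its bounded component *)

Section bounded_component.
Variable R : realType.

Lemma continuous_pair_at (T U V : topologicalType) (f : T -> U) (g : T -> V) (x : T) :
  {for x, continuous f} -> {for x, continuous g} ->
  {for x, continuous (fun z => (f z, g z))}.
Proof. by move=> cf cg; exact: (cvg_pair cf cg). Qed.

Definition direction (p x : R * R) : R * R :=
  ((x.1 - p.1) / eucl_dist x p, (x.2 - p.2) / eucl_dist x p).

Lemma direction_unit (p x : R * R) : x <> p ->
  (direction p x).1 ^+ 2 + (direction p x).2 ^+ 2 = 1.
Proof.
move=> /eucl_dist_gt0 xp; rewrite /= !expr_div_n -mulrDl -eucl_dist_sqr divff//.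
by rewrite expf_neq0// gt_eqF.
Qed.

Lemma continuous_direction (p x : R * R) : x <> p ->
  {for x, continuous (direction p)}.
Proof.
move=> /eucl_dist_gt0 xp.
have cd : (eucl_dist z p)^-1 @[z --> x] --> (eucl_dist x p)^-1.
  apply: cvgV; first by rewrite gt_eqF.
  under eq_fun do rewrite eucl_distC.
  by rewrite eucl_distC; exact: continuous_eucl_dist.
apply: continuous_pair_at; apply: cvgM => //; apply: cvgB;
  by [exact: cvg_cst|exact: cvg_fst|exact: cvg_snd].
Qed.

Lemma simple_closed_curve_compact (J : set (R * R)) :
  simple_closed_curve J -> compact J.
Proof.
by move=> [g [cg _ _ ->]]; apply: continuous_compact => //; exact: segment_compact.
Qed.

Lemma curve_sub_closure_component (J D : set (R * R)) :
  simple_closed_curve J -> bounded_complement_component J D ->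
  J `<=` closure D.
Proof.
move=> Jc [Db [p Jp DE]] q Jq; apply: contrapT => Dq.
have clJ : closed J.
  by apply: compact_closed; [exact: norm_hausdorff|exact: simple_closed_curve_compact].
have oJ : open (~` J) by exact: closed_openC.
have oD : open D by rewrite DE; exact: open_component.
have Dp : D p by rewrite DE; exact: connected_component_refl.
(* Hence the boundary of [D] lies on [J], and so in the set [A] below. *)
have bD x : closure D x -> ~ J x -> D x.
  by move=> Dx Jx; rewrite DE; apply: closure_component => //; rewrite -DE.
have [g0 [cg0 g001 g0i JE]] := Jc.
have [g [cg gE gJ]] := continuous_extend_segment cg0.
have gI (s : R) : 0 <= s <= 1 -> g0 s = g s by move=> ?; rewrite gE ?in_itv.
have g01 : g 0 = g 1 by rewrite -!gI ?lexx ?ler01.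
have gi : set_inj `[0, 1[ g.
  have sub s : s \in `[0, 1[%classic -> 0 <= s <= 1.
    by rewrite inE/= in_itv/= => /andP[-> /ltW].
  by move=> s t sI tI; rewrite -!gI ?sub//; exact: g0i.
have [s0 s01 gs0] : exists2 s, 0 <= s <= 1 & g s = q.
  move: Jq; rewrite JE => -[s + <-]; rewrite /= in_itv/= => s01.
  by exists s => //; rewrite gI.
have gp s : g s <> p by move=> gsp; apply: Jp; rewrite -gsp JE.
pose A := closure D `&` J.
have cA : closed A by apply: closedI => //; exact: closed_closure.
have [th cth thE] : exists2 th : R * R -> R, continuous th &
    forall x, A x -> direction p x = circle (th x).
  apply: (@extend_arg R g (direction p) A s0 cg g01 gi cA _ s01).
  - move=> x [_]; rewrite JE => -[s + <-]; rewrite /= in_itv/= => ?.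
    by exists s; rewrite ?gI//= in_itv.
  - by rewrite gs0 => -[].
  - by move=> s; apply: continuous_comp; [exact: cg|exact: continuous_direction].
  - by move=> s; exact: direction_unit.
(* On [closure D] the extended branch replaces the direction from [p], which is singular at [p]. The
   two definitions agree on the boundary of [D], so [F] is a continuous unit field on the whole
   plane. *)
pose F x := if `[< closure D x >] then circle (th x) else direction p x.
have F1 x : (F x).1 ^+ 2 + (F x).2 ^+ 2 = 1.
  rewrite /F; case: asboolP => [_|Dx]; first exact: cos2Dsin2.
  by apply: direction_unit => xp; apply/Dx/subset_closure; rewrite xp.
have cF : continuous F.
  apply/continuous_subspace_setT.
  have -> : [set: R * R] = closure D `|` ~` D.
    apply/seteqP; split=> // x _; have [Dx|Dx] := pselect (D x); last by right.
    by left; exact: subset_closure.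
  apply: withinU_continuous; [exact: closed_closure|exact: open_closedC| |].
    have E : {in closure D, @circle R \o th =1 F}.
      by move=> x; rewrite inE /F => Dx; rewrite asboolT.
    apply: (subspace_eq_continuous E); apply: continuous_subspaceT => x.
    apply: continuous_pair_at.
      by apply: continuous_comp; [exact: cth|exact: continuous_cos].
    by apply: continuous_comp; [exact: cth|exact: continuous_sin].
  have E : {in ~` D, direction p =1 F}.
    move=> x; rewrite inE /F => Dx; case: asboolP => // cDx.
    by apply: thE; split => //; apply: contrapT => /(bD _ cDx).
  apply: (subspace_eq_continuous E); apply: continuous_in_subspaceT => x.
  by rewrite inE => Dx; apply: continuous_direction => xp; apply: Dx; rewrite xp.
have [r rD] : exists r, forall x, closure D x -> eucl_dist p x <= r.
  have [M [_ DM]] := Db.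
  exists (2 * (`|p| + (M + 1))); apply: closure_eucl_dist_le => x Dx.
  apply: (le_trans (eucl_dist_le_norm _ _)); rewrite ler_pM2l//.
  by rewrite (le_trans (ler_normB _ _))// lerD2l DM// ltrDl.
(* The circle of radius [M] about [p] lies outside [closure D], where [F] is still the direction
   from [p]; the square [K] contains this circle and is star-shaped about [p]. *)
pose M := `|r| + 1.
have rM : r < M by rewrite /M (le_lt_trans (ler_norm r))// ltrDl.
have M0 : 0 < M by rewrite /M ltr_wpDl.
pose K := `[p.1 - M, p.1 + M] `*` `[p.2 - M, p.2 + M].
have [||psi [cpsi psiE]] := @circle_lift R _ F K p cF F1.
- by apply: compact_setX; exact: segment_compact.
- move=> x t [/=]; rewrite !in_itv/= => /andP[x1 x1'] /andP[x2 x2'] /andP[t0 t1].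
  have tM (d : R) : - M <= d <= M -> - M <= t * d <= M.
    rewrite -!ler_norml normrM (ger0_norm t0) => dM.
    by rewrite (le_trans _ dM)// ler_piMl.
  have /tM/andP[h1 h1'] : - M <= x.1 - p.1 <= M by apply/andP; split; lra.
  have /tM/andP[h2 h2'] : - M <= x.2 - p.2 <= M by apply/andP; split; lra.
  by split; rewrite /= in_itv/= /GRing.scale/=; apply/andP; split; lra.
pose gam (t : R) := (p.1 + M * cos t, p.2 + M * sin t).
have gamK t : K (gam t).
  have := cos_max t; have := sin_max t; rewrite !ler_norml => /andP[? ?] /andP[? ?].
  by split; rewrite /= in_itv/=; apply/andP; split; nra.
have dgam t : eucl_dist (gam t) p = M.
  rewrite /eucl_dist /= (addrC p.1) (addrC p.2) !addrK !exprMn -mulrDr cos2Dsin2.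
  by rewrite mulr1 sqrtr_sqr gtr0_norm.
have Fgam t : F (gam t) = circle t.
  rewrite /F asboolF; last first.
    by move=> /rD; rewrite eucl_distC dgam leNgt rM.
  rewrite /direction dgam /= (addrC p.1) (addrC p.2) !addrK.
  by rewrite /circle; congr pair; rewrite mulrC mulKf// gt_eqF.
(* Along the large circle [F] makes one full turn, while [psi] would be a single-valued argument for
   it. *)
apply: (@circle_no_lift R (psi \o gam)).
- apply: continuous_subspaceT => t; apply: continuous_comp; last exact: cpsi.
  apply: continuous_pair_at; apply: cvgD; try exact: cvg_cst; apply: cvgM; try exact: cvg_cst.
    exact: continuous_cos.
  exact: continuous_sin.
- by rewrite /= /gam mulr_natl cos2pi sin2pi cos0 sin0.
- by move=> t _; rewrite /= -psiE// Fgam.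
Qed.

End bounded_component.

(** * Area *)

Section area.
Variable R : realType.

(** Measurability refers to the product sigma-algebra, so an open set is written as a countable
    union of open squares with rational centres and sizes; the squares not inside [U] are replaced
    by the empty set. *)
Lemma open_measurable_plane (U : set (R * R)) : open U ->
  measurable (U : set (measurableTypeR R * measurableTypeR R)).
Proof.
move=> oU.
pose B (i : rat * rat * rat) : set (R * R) :=
  `]ratr i.1.1 - ratr i.2, ratr i.1.1 + ratr i.2[ `*`
  `]ratr i.1.2 - ratr i.2, ratr i.1.2 + ratr i.2[.
rewrite (_ : U = \bigcup_i (if `[< B i `<=` U >] then B i else set0)).
  apply: countable_bigcupT_measurable => [|i]; first exact: countableP.
  by case: ifP => // _; apply: measurableX; exact: measurable_itv.
apply/seteqP; split=> [x Ux|x [i _]]; last by case: asboolP => // iU /iU.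
move: oU; rewrite openE => /(_ _ Ux) /nbhs_ballP[r /= r0 xr].
have [c] : exists c, ratr c \in `]0, r / 2[%R by apply: rat_in_itvoo; rewrite divr_gt0.
rewrite in_itv/= => /andP[c0 cr].
have [a] : exists a, ratr a \in `]x.1 - ratr c, x.1 + ratr c[%R by apply: rat_in_itvoo; lra.
rewrite in_itv/= => /andP[a1 a2].
have [b] : exists b, ratr b \in `]x.2 - ratr c, x.2 + ratr c[%R by apply: rat_in_itvoo; lra.
rewrite in_itv/= => /andP[b1 b2].
exists (a, b, c) => //; rewrite asboolT.
  by split; rewrite /= in_itv/=; apply/andP; split; lra.
move=> y [/=]; rewrite !in_itv/= => /andP[y1 y1'] /andP[y2 y2'].
apply: xr; rewrite -ball_normE /ball_/= prod_normE gt_max /= !ltr_norml.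
by apply/andP; split; apply/andP; split; lra.
Qed.

(** The disjoint regions all lie in the square of side [2 * L] circumscribed about the disc, whose
    area bounds the sum of theirs. *)
Lemma area_packing (E : nat -> set (R * R)) (X : {fset nat}) (c : R * R) (L v : R) :
  0 < L -> (forall k, k \in X -> open (E k)) -> trivIset [set` X] E ->
  (forall k, k \in X -> E k `<=` disc c L) ->
  (forall k, k \in X -> (v%:E <= area (E k))%E) ->
  (#|` X|)%:R * v <= (2 * L) ^+ 2.
Proof.
move=> L0 oE tE EL vE.
pose box : set (R * R) := `[c.1 - L, c.1 + L] `*` `[c.2 - L, c.2 + L].
have abox : area box = ((2 * L) ^+ 2)%:E.
  have itvE a : lebesgue_measure (`[a - L, a + L]%classic : set R) = (2 * L)%:E.
    rewrite lebesgue_measure_itv/= lte_fin ifT; last by lra.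
    by rewrite -EFinB; congr EFin; ring.
  rewrite /area product_measure1E; try exact: measurable_itv.
  transitivity ((2 * L)%:E * (2 * L)%:E)%E; last by rewrite -EFinM expr2.
  by congr (_ * _)%E; exact: itvE.
have mE k : k \in X -> measurable (E k : set (measurableTypeR R * measurableTypeR R)).
  by move=> kX; apply: open_measurable_plane; exact: oE.
rewrite -lee_fin -abox.
apply: (@le_trans _ _ (\sum_(k <- X) area (E k))%E).
  rewrite -sum1_size natr_sum mulr_suml -sumEFin big_seq [leRHS]big_seq.
  by apply: lee_sum => k kX; rewrite mul1r vE.
have := @measure_fbigsetU _ _ _ (@lebesgue_measure R \x @lebesgue_measure R)%E _ X E mE tE.
move=> /esym ->; apply: le_measure.
- by rewrite inE -bigcup_fset; apply: fin_bigcup_measurable => //; exact: finite_finset.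
- by rewrite inE; apply: measurableX; exact: measurable_itv.
rewrite -bigcup_fset => x [k kX /(EL _ kX) /ltW xc].
have := le_trans (eucl_dist_fst c x) xc; have := le_trans (eucl_dist_snd c x) xc.
rewrite !ler_norml => /andP[? ?] /andP[? ?].
by split; rewrite /= in_itv/=; apply/andP; split; lra.
Qed.
End area.

(** * Curves against discs *)

Section comparison.
Variable R : realType.
Implicit Types (S : set (R * R)).

(** The outer curve, of index 0, is set aside: it is sent to an arbitrary point of [B], which
    enlarges a fibre by at most one. *)
Lemma counting_le_fiber_succ (U : choiceType) (A : set nat) (B : set U)
    (f : nat -> U) (m : nat) : B !=set0 ->
  (forall k, A k.+1 -> B (f k)) ->
  (forall u (X : {fset nat}), B u ->
    (forall k, k \in X -> A k.+1 /\ f k = u) -> (#|` X| <= m)%N) ->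
  (counting A <= m.+1%:R%:E * counting B :> \bar R)%E.
Proof.
move=> [b Bb] AB fm.
pose f' k := if k is k'.+1 then f k' else b.
apply: (@counting_le_fiber _ _ _ _ _ f') => //.
  by case=> [|k] Ak //=; exact: AB.
move=> u X Bu Xu; rewrite (cardfsD1 0%N) -add1n leq_add ?leq_b1//.
pose Y := [fset k.-1 | k in (X `\ 0)%fset]%fset.
have <- : #|` Y| = #|` (X `\ 0)%fset|.
  rewrite card_in_imfset//= => -[|i] [|j]; rewrite !inE//= => _ _ ->//.
apply: (fm u) => // k /imfsetP[[|j]]; rewrite !inE//= => jX ->.
by have [] := Xu _ jX.
Qed.

Lemma trivIset_disc_dist (P : set (R * R)) (e : R) (p q : R * R) : 0 < e ->
  trivIset P (fun p => disc p e) -> P p -> P q -> p <> q ->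
  e <= eucl_dist p q.
Proof.
move=> e0 tP Pp Pq pq; rewrite leNgt; apply/negP => pqe; apply: pq.
by apply: (tP p q Pp Pq); exists q; split; [exact: pqe|exact: disc_center].
Qed.

Lemma max_disjoint_discs_ge S (P : set (R * R)) (e : R) : P `<=` S ->
  trivIset P (fun p => disc p e) -> (counting P <= max_disjoint_discs S e)%E.
Proof. by move=> PS tP; apply: ereal_sup_ubound; exists P. Qed.

Lemma simple_closed_curve_nonempty (J : set (R * R)) :
  simple_closed_curve J -> J !=set0.
Proof.
by move=> [g [_ _ _ ->]]; exists (g 0), 0; rewrite //= in_itv/= lexx ler01.
Qed.

Lemma simple_closed_curve_bounded (J : set (R * R)) :
  simple_closed_curve J -> bounded_set J.
Proof. by move=> /simple_closed_curve_compact /compact_bounded. Qed.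

Lemma simple_closed_curve_diam_gt0 (J : set (R * R)) :
  simple_closed_curve J -> 0 < diam J.
Proof.
move=> Jc; have Jb := simple_closed_curve_bounded Jc.
have [g [_ _ gi JE]] := Jc.
have gJ s : 0 <= s <= 1 -> J (g s) by move=> ?; rewrite JE; exists s; rewrite //= in_itv.
(* The parameters 0 and 1/2 both lie in the half-open interval on which the curve is injective. *)
pose a : R := 2^-1.
have a0 : 0 < a by rewrite invr_gt0.
have a1 : a < 1 by rewrite invf_lt1// ltr1n.
have J0 : J (g 0) by apply: gJ; rewrite lexx ler01.
have Ja : J (g a) by apply: gJ; rewrite !ltW.
apply: lt_le_trans (diam_ge Jb J0 Ja); apply: eucl_dist_gt0 => /gi.
rewrite !inE/= !in_itv/= lexx ltr01 ltW//= a1 => /(_ isT isT) a0'.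
by rewrite -a0' ltxx in a0.
Qed.

Lemma component_open (J D : set (R * R)) : simple_closed_curve J ->
  bounded_complement_component J D -> open D.
Proof.
move=> Jc [_ [p _ ->]]; apply/open_component/closed_openC.
apply: compact_closed; first exact: norm_hausdorff.
exact: simple_closed_curve_compact.
Qed.

(** * Comparison of the curve count and the disc count for a packing *)

Section packing_facts.
Variables (C D : nat -> set (R * R)).
Hypothesis CD : packing C D.
Let S := residual_set D.

(** A curve misses its own region, which is a component of its complement. Being in the closure of
    that region, it also misses every other open region [D j.+1], which would otherwise meet
    [D k.+1]. *)
Lemma curve_sub_residual k : C k.+1 `<=` S.
Proof.
have [Cc CDc C0 DD] := CD; move=> x Cx; split; first exact: C0 Cx.
move=> [j _ Dx]; have [jk|jk] := eqVneq j k.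
  have [_ [p _ DE]] := CDc j.+1; move: Dx; rewrite DE => /connected_component_sub.
  by rewrite jk.
have := curve_sub_closure_component (Cc k.+1) (CDc k.+1) Cx.
have Dn : nbhs x (D j.+1) by apply: open_nbhs_nbhs; split => //; exact: component_open (Cc _) (CDc _).
move=> /(_ _ Dn)[y [Dky Djy]].
by have := DD _ _ jk; rewrite -subset0 => /(_ y); apply.
Qed.

Lemma residual_bounded : bounded_set S.
Proof.
have [_ /(_ 0%N)[[M [_ DM]] _] _ _] := CD.
have b x : closure (D 0%N) x -> eucl_dist 0 x <= 2 * (M + 1).
  apply: closure_eucl_dist_le => y Dy; apply: (le_trans (eucl_dist_le_norm _ _)).
  by rewrite ler_pM2l// sub0r normrN DM// ltrDl.
exists (2 * (M + 1)); split; first exact: num_real.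
move=> r Mr x [/b xM _]; have := norm_le_eucl_dist 0 x.
by rewrite sub0r normrN => /le_trans; apply; exact: le_trans xM (ltW Mr).
Qed.

Lemma residual_diam_gt0 : 0 < diam S.
Proof.
have [Cc _ _ _] := CD; apply: lt_le_trans (simple_closed_curve_diam_gt0 (Cc 1%N)) _.
have [x Cx] := simple_closed_curve_nonempty (Cc 1%N).
apply: diam_le.
  apply: le_trans (eucl_dist_ge0 x x) _.
  by apply: diam_ge residual_bounded _ _; exact: curve_sub_residual Cx.
move=> p q Cp Cq; apply: diam_ge residual_bounded _ _.
  exact: curve_sub_residual Cp.
exact: curve_sub_residual Cq.
Qed.

Lemma curvature_index k (x : R) : 0 < x -> (diam (C k))^-1 <= x ->
  x^-1 <= diam (C k).
Proof.
have [Cc _ _ _] := CD => x0 Cx; rewrite -[leRHS]invrK lef_pV2 ?posrE//.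
by rewrite invr_gt0 simple_closed_curve_diam_gt0.
Qed.

Lemma discs_le_curves : all_scales C S ->
  exists K a : R, [/\ 0 < K, 0 < a & \forall x \near +oo,
    (max_disjoint_discs S x^-1 <= K%:E * curvature_distribution C (a * x))%E].
Proof.
have [Cc _ _ _] := CD; move=> [beta beta1 CS].
have beta0 : 0 < beta by exact: lt_le_trans beta1.
(* Centres assigned to one curve are within [(beta + 1) * e] of any fixed point of it, where [e] is
   [x^-1], and the integer used here is at least [beta + 1]. The dilation is [beta] because the
   assigned curves have diameter at least [e / beta]. *)
have [m m0 sep] := separated_card_le R (Num.truncn beta).+2.
exists m%:R, beta; split; rewrite ?ltr0n//; near=> x.
have x0 : 0 < x by near: x; exact: nbhs_pinfty_gt.
have e0 : 0 < x^-1 by rewrite invr_gt0.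
have eS : x^-1 <= diam S.
  have Sx : (diam S)^-1 <= x by near: x; apply: nbhs_pinfty_ge; exact: num_real.
  by rewrite -[leRHS]invrK lef_pV2// posrE invr_gt0 residual_diam_gt0.
apply: ge_ereal_sup => _ [P [PS tP] <-].
have /choice[f fP] : forall p, exists k, P p ->
    C k `&` disc p x^-1 !=set0 /\ beta^-1 * x^-1 <= diam (C k) <= beta * x^-1.
  move=> p; have [Pp|nP] := pselect (P p); last by exists 0%N.
  have [|k k1 k2] := CS p x^-1 (PS _ Pp); first by rewrite e0.
  by exists k.
apply: (@counting_le_fiber _ _ _ _ _ f) => // [p /fP[_ /andP[+ _]]|k X _ XP].
  rewrite -invfM => bC /=; rewrite -[leRHS]invrK lef_pV2 ?posrE//.
    by rewrite simple_closed_curve_diam_gt0.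
  by rewrite invr_gt0 mulr_gt0.
have [c Ckc] := simple_closed_curve_nonempty (Cc k).
apply: (sep x^-1 c) => // [p /XP[/fP [[y [+ yp]] /andP[_ +]] /= fk]|p q].
  rewrite fk => Cy Ck.
  apply: (le_trans (eucl_dist_triangle y p c)).
  have yc : eucl_dist y c <= beta * x^-1.
    apply: le_trans Ck; apply: diam_ge => //; exact: simple_closed_curve_bounded.
  have bt : beta + 1 <= (Num.truncn beta).+2%:R.
    by rewrite -natr1 lerD2r ltW// truncnS_gt.
  have : (beta + 1) * x^-1 <= (Num.truncn beta).+2%:R * x^-1 by rewrite ler_pM2r.
  move: (yp : eucl_dist p y < x^-1); lra.
by move=> /XP[Pp _] /XP[Pq _]; exact: (trivIset_disc_dist e0 tP Pp Pq).
Unshelve. all: by end_near. Qed.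

Lemma curves_le_discs_of_separation : relative_separation C ->
  exists K a : R, [/\ 0 < K, 0 < a & \forall x \near +oo,
    (curvature_distribution C x <= K%:E * max_disjoint_discs S (a * x)^-1)%E].
Proof.
have [Cc _ _ _] := CD; move=> [delta d0 sepC].
(* Points on distinct counted curves are at least [delta / x] apart, so discs of half that radius
   about them are disjoint. Each point serves one curve, and the factor 2 makes room for the curve
   of index 0. *)
exists 2%:R, (2 / delta); split; rewrite ?divr_gt0//; near=> x.
have x0 : 0 < x by near: x; exact: nbhs_pinfty_gt.
(* The curve of index 1 is then counted, so the set [P] of centres is not empty. *)
have x1 : (diam (C 1%N))^-1 <= x by near: x; apply: nbhs_pinfty_ge; exact: num_real.
have /choice[p Cp] : forall k, exists p, C k.+1 p.
  by move=> k; exact: simple_closed_curve_nonempty.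
set I := [set k | (diam (C k))^-1 <= x].
have dp j k : j <> k -> I j.+1 -> I k.+1 -> delta / x <= eucl_dist (p j) (p k).
  move=> jk Ij Ik; have jk1 : j.+1 != k.+1 by apply/eqP => -[].
  have := sepC _ _ jk1; set m := Num.min _ _.
  have mx : x^-1 <= m by rewrite le_min !curvature_index.
  have m0 : 0 < m by apply: lt_le_trans mx; rewrite invr_gt0.
  rewrite ler_pdivlMr// => dm.
  apply: (@le_trans _ _ (setdist (C j.+1) (C k.+1))).
    by apply: le_trans dm; rewrite ler_pM2l.
  apply: ge_inf; last by exists (p j) => //; exists (p k).
  by exists 0 => _ [? _ [? _ <-]]; exact: eucl_dist_ge0.
pose P := [set p k | k in [set k | I k.+1]].
apply: (@le_trans _ _ (2%:R%:E * counting P)%E); last first.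
  rewrite lee_pmul2l//; apply: max_disjoint_discs_ge.
    by move=> _ [k _ <-]; exact: curve_sub_residual (Cp k).
  move=> _ _ [j Ij <-] [k Ik <-] [y [jy ky]]; congr p; apply: contrapT => jk.
  have := dp _ _ jk Ij Ik; apply/negP; rewrite -ltNge.
  apply: (le_lt_trans (eucl_dist_triangle y _ _)).
  have -> : delta / x = (2 / delta * x)^-1 + (2 / delta * x)^-1.
    by field; rewrite !gt_eqF.
  by rewrite ltrD// eucl_distC.
apply: (@counting_le_fiber_succ _ _ _ p 1); first by exists (p 0%N), 0%N.
  by move=> k Ik; exists k.
move=> u X _ XI; rewrite leqNgt; apply/negP => X1.
have [j jX] : exists j, j \in X.
  by have [X0|[j]] := fset_0Vmem X; [rewrite X0 cardfs0 in X1|exists j].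
have [X0|[k]] := fset_0Vmem (X `\ j)%fset.
  by rewrite (cardfsD1 j) jX X0 cardfs0 in X1.
rewrite !inE => /andP[/eqP kj kX].
have [[Ij pj] [Ik pk]] := (XI _ jX, XI _ kX).
have := dp _ _ kj Ik Ij; rewrite pk pj eucl_distxx leNgt divr_gt0//.
Unshelve. all: by end_near. Qed.

Lemma curves_le_discs_of_co_fatness : co_fatness D ->
  exists K a : R, [/\ 0 < K, 0 < a & \forall x \near +oo,
    (curvature_distribution C x <= K%:E * max_disjoint_discs S (a * x)^-1)%E].
Proof.
have [Cc CDc _ DD] := CD; move=> [tau tau0 fatD].
(* Pieces of area at least [tau * (e / 4) ^+ 2] will be packed in a disc of radius [3 * e], whose
   circumscribed square has area [36 * e ^+ 2 = 576 * (e / 4) ^+ 2]. *)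
pose m := Num.truncn (576 / tau).
exists m.+1%:R, 1; split; rewrite ?ltr0n//; near=> x.
have x0 : 0 < x by near: x; exact: nbhs_pinfty_gt.
rewrite mul1r; set e := x^-1; have e0 : 0 < e by rewrite invr_gt0.
have [P [PS tP Pmax]] := ex_maximal_disjoint_subcollection (fun p : R * R => disc p e) S.
(* Otherwise the disc about [p] could be added to the maximal family. *)
have Pnear p : S p -> exists2 z, P z & eucl_dist p z < 2 * e.
  move=> Sp; apply: contrapT => far.
  have nP z : P z -> ~ (disc p e `&` disc z e !=set0).
    move=> Pz [y [py zy]]; apply: far; exists z => //.
    apply: (le_lt_trans (eucl_dist_triangle y _ _)).
    by rewrite mulr_natl mulr2n ltrD// eucl_distC.
  have Pp : ~ P p by move=> /nP; apply; exists p; split; exact: disc_center.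
  apply: (Pmax (P `|` [set p])).
  - by split=> [z Pz|/(_ p) Hp]; [left|apply/Pp/Hp; right].
  - by move=> z [/PS//|->].
  - move=> y z [Py|->] [Pz|->]//; first exact: tP.
      by rewrite setIC => /(nP _ Py).
    by move=> /(nP _ Pz).
have /choice[p Cp] : forall k, exists p, C k.+1 p.
  by move=> k; exact: simple_closed_curve_nonempty.
have /choice[z zP] : forall k, exists z, P z /\ eucl_dist (p k) z < 2 * e.
  by move=> k; have [z] := Pnear _ (curve_sub_residual (Cp k)); exists z.
apply: (@le_trans _ _ (m.+1%:R%:E * counting P)%E); last first.
  by rewrite lee_pmul2l//; exact: max_disjoint_discs_ge.
apply: (@counting_le_fiber_succ _ _ _ z m); first by exists (z 0%N); have [] := zP 0%N.
  by move=> k _; have [] := zP k.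
move=> u X _ XI.
have e4 : 0 < e / 4 by rewrite divr_gt0.
(* Co-fatness concerns discs centred in the region, so the point on the curve is moved slightly into
   [D k.+1]. *)
have /choice[q qP] : forall k, exists q, D k.+1 q /\ eucl_dist (p k) q < e / 4.
  move=> k; have := curve_sub_closure_component (Cc k.+1) (CDc k.+1) (Cp k).
  have pn : nbhs (p k) (disc (p k) (e / 4)).
    by apply: open_nbhs_nbhs; split; [exact: open_disc|exact: disc_center].
  by move=> /(_ _ pn)[y [Dy py]]; exists y.
have := @area_packing R (fun k => D k.+1 `&` disc (q k) (e / 4)) X u (3 * e)
  (tau * (e / 4) ^+ 2).
have -> : (2 * (3 * e)) ^+ 2 = (576 * (e / 4) ^+ 2) by field.
rewrite mulrA ler_pM2r ?exprn_gt0// -ler_pdivlMr// => H.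
suff : #|` X|%:R <= 576 / tau by rewrite -truncn_ge_nat// divr_ge0// ltW.
apply: H => [|k kX||k kX|k kX].
- by rewrite mulr_gt0.
- by apply: openI; [exact: component_open (Cc _) (CDc _)|exact: open_disc].
- move=> j k _ _ [y [[Dj _] [Dk _]]]; apply: contrapT => /eqP jk.
  by have := DD _ _ jk; rewrite -subset0 => /(_ y); apply.
(* The distance from [u] to [y] is below [2 * e + e / 4 + e / 4]. *)
- move=> y [_ qy]; have [_ zk] := XI _ kX; have [_ pz] := zP k; have [_ pq] := qP k.
  have h1 := eucl_dist_triangle (p k) u y.
  have h2 := eucl_dist_triangle (q k) (p k) y.
  rewrite zk eucl_distC in pz; move: (qy : eucl_dist (q k) y < e / 4) => qy'.
  rewrite /disc/=; lra.
(* If the small disc contained [D k.+1], the curve, lying in the closure, would have diameter at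
   most [e / 2], whereas a counted curve has diameter at least [e]. *)
- have [Dq pq] := qP k; apply: fatD => // Dsub.
  have [Ik _] := XI _ kX.
  have eC : e <= diam (C k.+1) by exact: curvature_index.
  suff : diam (C k.+1) <= e / 2 by lra.
  apply: diam_le => [|a b /(curve_sub_closure_component (Cc _) (CDc _)) Da
    /(curve_sub_closure_component (Cc _) (CDc _)) Db]; first by lra.
  have cl := @closure_eucl_dist_le R (q k) (e / 4) (D k.+1) (fun y Dy => ltW (Dsub y Dy)).
  have := eucl_dist_triangle (q k) a b; have := cl _ Da; have := cl _ Db.
  by rewrite (eucl_distC a (q k)); lra.
Unshelve. all: by end_near. Qed.

End packing_facts.
End comparison.

Theorem proposition2 (R : realType) (C D : nat -> set (R * R)) :
  packing C D -> homogeneous C D ->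
  limf_esup (fun x : R => lne (curvature_distribution C x) / (ln x)%:E)%E
    (pinfty_nbhs R) = dim_ubox (residual_set D) /\
  limf_einf (fun x : R => lne (curvature_distribution C x) / (ln x)%:E)%E
    (pinfty_nbhs R) = dim_lbox (residual_set D).
Proof.
move=> CD [_ scales sepfat].
pose n (x : R) := lne (max_disjoint_discs (residual_set D) x^-1).
pose nr (x : R) := (n x / (ln x)%:E)%E.
(* The substitution [x = 1 / e] turns both dimensions into limits at infinity, where the two
   counting functions can be compared. *)
have E : (fun e : R => lne (max_disjoint_discs (residual_set D) e) / (ln (1 / e))%:E)%E =
    (fun e : R => nr e^-1).
  by apply/funext => e; rewrite /nr /n invrK div1r.
rewrite /dim_ubox /dim_lbox E (limf_esup_at_rightV nr) (limf_einf_at_rightV nr).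
have [K [a [K0 a0 nN]]] := discs_le_curves CD scales.
have {}nN : \forall x \near +oo,
    (n x <= (ln K)%:E + lne (curvature_distribution C (a * x)%R))%E.
  by apply: filterS nN => x; exact: lne_le_mul.
have [L [b [L0 b0 Nn]]] : exists K a : R, [/\ 0 < K, 0 < a & \forall x \near +oo,
    (curvature_distribution C x <=
     K%:E * max_disjoint_discs (residual_set D) (a * x)^-1)%E].
  by case: sepfat; [exact: curves_le_discs_of_separation|exact: curves_le_discs_of_co_fatness].
have {}Nn : \forall x \near +oo,
    (lne (curvature_distribution C x) <= (ln L)%:E + n (b * x)%R)%E.
  by apply: filterS Nn => x; exact: lne_le_mul.
split; apply/eqP; rewrite eq_le; apply/andP; split.
- exact: limf_esup_log_rate b0 Nn.
- exact: limf_esup_log_rate a0 nN.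
- exact: limf_einf_log_rate b0 Nn.
- exact: limf_einf_log_rate a0 nN.
Qed.
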